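(* Let $d\in\{1,2\}$ and let $P$ be a hyperuniform stationary isotropic locally square integrable point process on $\mathbb R^d$ that is not (linearly) number rigid on some bounded measurable set $A\subset\mathbb R^d$. Then $$\int_{\mathbb R^d}|t|^d\,|\mathsf C|(dt)=\infty ,$$ where $\mathsf C$ is the correlation measure of $P$ and $|\mathsf C|$ its total variation measure.
   Context: Stationary (resp. isotropic) means that the law of $P$ is invariant under translations (resp. rotations). Let $I_P(f)=\int f\,dP$. The correlation measure $\mathsf C$ is characterized by $\mathrm{Cov}(I_P(f),I_P(g))=\int\int f(y)g(x+y)\,\mathsf C(dx)\,dy$ for bounded measurable compactly supported $f,g$. $P$ is hyperuniform if $\mathrm{Var}(P(B(0,r)))/\mathrm{Leb}(B(0,r))\to0$ as $r\to\infty$. $P$ is linearly number rigid on a bounded measurable set $A$ if $\inf_h\mathrm{Var}(P(A)-I_P(h))=0$, the infimum being over bounded measurable compactly supported $h$ vanishing on $A$. *)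

(* Defs.v *)
From HB Require Import structures.
From mathcomp Require Import all_boot all_order all_algebra.
From mathcomp Require Import all_classical all_reals all_analysis.
From mathcomp Require Import measurable_realfun.

Set Implicit Arguments.
Unset Strict Implicit.
Unset Printing Implicit Defensive.

Import Order.TTheory GRing.Theory Num.Theory.
Import numFieldNormedType.Exports.

Local Open Scope classical_set_scope.
Local Open Scope ring_scope.

(* R^n is ['rV[R]_n]. Its sigma-algebra is generated by the coordinates, which
   is the Borel one; this mirrors the library instance on [n.-tuple T]. *)
Definition rV_display : measure_display -> measure_display.
Proof. exact. Qed.

Section rV_measurable.
Context (R : realType) (n : nat).

Definition rV_coord (i : 'I_n) (x : 'rV[R]_n) : R := x ord0 i.

Definition rV_measurable : set (set 'rV[R]_n) := g_sigma_preimage rV_coord.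

Let rV_set0 : rV_measurable set0.
Proof. exact: sigma_algebra0. Qed.

Let rV_setC A : rV_measurable A -> rV_measurable (~` A).
Proof. exact: sigma_algebraC. Qed.

Let rV_bigcup (F : (set 'rV[R]_n)^nat) :
  (forall i, rV_measurable (F i)) -> rV_measurable (\bigcup_i (F i)).
Proof. exact: sigma_algebra_bigcup. Qed.

HB.instance Definition _ :=
  @isMeasurable.Build (rV_display default_measure_display)
    'rV[R]_n rV_measurable rV_set0 rV_setC rV_bigcup.

End rV_measurable.

Section rV_measurability.
Context (R : realType).

Lemma measurable_rV_coord n (i : 'I_n) :
  measurable_fun [set: 'rV[R]_n] (@rV_coord R n i).
Proof.
move=> _ Y mY; rewrite setTI; apply: sub_sigma_algebra => /=.
rewrite -bigcup_seq/=; exists i => /=; first by rewrite mem_index_enum.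
by exists Y => //; rewrite setTI.
Qed.

Lemma measurable_fun_rV d (T : measurableType d) n (f : T -> 'rV[R]_n) :
  (forall i, measurable_fun [set: T] (fun t => f t ord0 i)) ->
  measurable_fun [set: T] f.
Proof.
move=> mf _ Y mY; rewrite setTI.
have : preimage_set_system setT f (@rV_measurable R n) `<=` measurable.
  rewrite /rV_measurable -g_sigma_preimage_comp.
  apply: smallest_sub; first exact: sigma_algebra_measurable.
  rewrite -bigcup_seq/=; apply: bigcup_sub => i _.
  by move=> A [B mB <-]; exact: mf.
by apply; exists Y => //; rewrite setTI.
Qed.

Definition rV_cons n (p : 'rV[R]_n * R) : 'rV[R]_n.+1 :=
  row_mx (const_mx p.2 : 'rV[R]_1) p.1.

Lemma measurable_rV_cons n : measurable_fun setT (@rV_cons n).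
Proof.
apply: measurable_fun_rV => i.
rewrite (_ : (fun t => _) = fun p : 'rV[R]_n * R =>
    match @fintype.split 1 n i with
    | inl _ => p.2 | inr j => rV_coord j p.1 end); last first.
  apply/funext => p; rewrite /rV_cons mxE.
  by case: fintype.split => // j; rewrite mxE.
case: fintype.split => j; first exact: measurable_snd.
exact: (measurableT_comp (measurable_rV_coord j) measurable_fst).
Qed.

End rV_measurability.

(* Lebesgue measure on R^n, as an iterated product. *)
Section lebesgue_rV.
Context (R : realType).
Local Open Scope ereal_scope.

Definition leb_cons n (mu : {measure set 'rV[R]_n -> \bar R}) :
    set 'rV[R]_n.+1 -> \bar R :=
  pushforward (mu \x (@lebesgue_measure R)) (@rV_cons R n).

Section leb_cons_measure.
Context n (mu : {measure set 'rV[R]_n -> \bar R}).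

Let leb_cons0 : leb_cons mu set0 = 0.
Proof. by rewrite /leb_cons /pushforward preimage_set0 measure0. Qed.

Let leb_cons_ge0 A : 0 <= leb_cons mu A.
Proof. by rewrite /leb_cons /pushforward; exact: measure_ge0. Qed.

Let leb_cons_sigma_additive : semi_sigma_additive (leb_cons mu).
Proof.
have H := @measurable_rV_cons R n.
move=> F mF tF mUF; rewrite /leb_cons /pushforward preimage_bigcup.
apply: measure_semi_sigma_additive.
- by move=> k; rewrite -[X in measurable X]setTI; exact: H.
- apply/trivIsetP => /= i j _ _ ij; rewrite -preimage_setI.
  by move/trivIsetP : tF => /(_ _ _ _ _ ij) ->//; rewrite preimage_set0.
- by rewrite -preimage_bigcup -[X in measurable X]setTI; exact: H.
Qed.

HB.instance Definition _ := isMeasure.Build _ _ _ (leb_cons mu)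
  leb_cons0 leb_cons_ge0 leb_cons_sigma_additive.

End leb_cons_measure.

Fixpoint leb n : {measure set 'rV[R]_n -> \bar R} :=
  match n with
  | 0%N => dirac (0%R : 'rV[R]_0)
  | k.+1 => leb_cons (leb k)
  end.

End lebesgue_rV.
Arguments leb {R} n.

Section euclidean.
Context {R : realType} {n : nat}.

(* The library norm on ['rV[R]_n] is the sup norm. *)
Definition enorm (x : 'rV[R]_n) : R := Num.sqrt (\sum_i x ord0 i ^+ 2).

Definition eball (r : R) : set 'rV[R]_n := [set x | enorm x < r].

Definition rotation (Q : 'M[R]_n) : Prop := Q *m Q^T = 1%:M /\ \det Q = 1.

Definition test_function (f : 'rV[R]_n -> R) : Prop :=
  [/\ measurable_fun setT f, [bounded f x | x in setT] &
      compact (closure [set x | f x != 0])].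

Definition locally_finite (mu : set 'rV[R]_n -> \bar R) : Prop :=
  forall A : set 'rV[R]_n, measurable A -> bounded_set A -> (mu A < +oo)%E.

End euclidean.

(* A signed Radon measure on R^n, given by its Jordan decomposition. Both parts
   may have infinite mass, so this is not a [charge] (which is finite). *)
Record signed_radon (R : realType) (n : nat) := SignedRadon {
  spos : {measure set 'rV[R]_n -> \bar R} ;
  sneg : {measure set 'rV[R]_n -> \bar R} ;
  spos_locally_finite : locally_finite spos ;
  sneg_locally_finite : locally_finite sneg ;
  s_mutually_singular :
    exists2 H, measurable H & spos (~` H) = 0%E /\ sneg H = 0%E
}.

Definition total_variation_measure (R : realType) (n : nat) (C : signed_radon R n) :
  {measure set 'rV[R]_n -> \bar R} := measure_add (spos C) (sneg C).

Definition signed_integral (R : realType) (n : nat) (C : signed_radon R n)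
  (h : 'rV[R]_n -> R) : R := \int[spos C]_x h x - \int[sneg C]_x h x.

(* A random measure on R^n over the probability space (Omega, Pr) is a kernel
   from Omega: [P w] is a measure for each [w], and [w |-> P w A] is measurable
   for each measurable [A]. *)
Section point_process.
Context {R : realType} {n : nat} {d' : measure_display}.
Context {Omega : measurableType d'}.
Variables (Pr : probability Omega R) (P : R.-ker Omega ~> 'rV[R]_n).

(* Multiplicities are allowed; local finiteness is contained in the condition. *)
Definition point_process : Prop :=
  forall w (A : set 'rV[R]_n), measurable A -> bounded_set A ->
    exists k : nat, P w A = k%:R%:E.

Definition locally_square_integrable : Prop :=
  forall A : set 'rV[R]_n, measurable A -> bounded_set A ->
    (\int[Pr]_w (P w A * P w A) < +oo)%E.

Definition npoints (A : set 'rV[R]_n) (w : Omega) : R := fine (P w A).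

Definition linear_stat (f : 'rV[R]_n -> R) (w : Omega) : R :=
  \int[P w]_x f x.

(* The sigma-algebra of path space generated by the evaluations at measurable
   sets; the law of [P] is [E |-> Pr [set w | E (P w)]] on it. *)
Definition path_events : set (set (set 'rV[R]_n -> \bar R)) :=
  <<s [set (fun m => m A) @^-1` B
      | A in (measurable : set (set 'rV[R]_n))
      & B in (measurable : set (set (\bar R)))] >>.

Definition law_invariant (g : 'rV[R]_n -> 'rV[R]_n) : Prop :=
  forall E, path_events E ->
    Pr [set w | E (pushforward (P w) g)] = Pr [set w | E (P w)].

Definition stationary : Prop :=
  forall x : 'rV[R]_n, law_invariant (fun y => y + x).

Definition isotropic : Prop :=
  forall Q : 'M[R]_n, rotation Q -> law_invariant (fun y => y *m Q).

Definition hyperuniform : Prop :=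
  ('V_Pr[npoints (eball r)] / leb n (eball r))%E @[r --> +oo] --> 0%E.

Definition linearly_number_rigid (A : set 'rV[R]_n) : Prop :=
  ereal_inf [set ('V_Pr[fun w => (npoints A w - linear_stat h w)%R])%E
    | h in [set h | test_function h /\ forall x, A x -> h x = 0]] = 0%E.

Definition correlation_measure (C : signed_radon R n) : Prop :=
  forall f g, test_function f -> test_function g ->
    covariance Pr (linear_stat f) (linear_stat g) =
    (\int[leb n]_y (signed_integral C (fun x => (f y * g (x + y))%R))%:E)%E.

End point_process.

(* Main.v *)
Require Import Defs.
From HB Require Import structures.
From mathcomp Require Import all_boot all_order all_algebra.
From mathcomp Require Import all_classical all_reals all_analysis.
From mathcomp Require Import measurable_realfun.
From mathcomp Require Import ring lra.

Set Implicit Arguments.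
Unset Strict Implicit.
Unset Printing Implicit Defensive.

Import Order.TTheory GRing.Theory Num.Theory.
Import numFieldNormedType.Exports.

Local Open Scope classical_set_scope.
Local Open Scope ring_scope.

(** The statement is proved by contraposition: a finite moment
    int |t|^d |C|(dt) forces linear number rigidity on every bounded
    measurable set A.

    For a test function f let c_f(x) = int f(y) f(x + y) dy.  A finite moment
    makes both parts of C finite, so Fubini turns the defining property of C
    into Var(I_P(f)) = int c_f dC ([variance_linear_stat]).  Hyperuniformity
    then says that C has total mass zero: with f the indicator of the ball of
    radius r, c_f(x) divided by the volume of the ball tends to 1 boundedly,
    and dominated convergence gives C(R^d) = 0 ([hyperuniform_total_mass]).
    The constant c_f(0) can therefore be subtracted under the integral, and
    since c_f(0) - c_f(x) is half of the energy
        E(f, x) = int (f(x + y) - f(y))^2 dy >= 0,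
    the variance is at most int E(f, x) C^-(dx), where C^- is the negative
    part of C ([variance_le_energy]).

    It remains to find test functions f_k equal to 1 on A for which E(f_k, x)
    tends to 0 for every x while staying below a multiple of |x|^d; dominated
    convergence then sends Var(I_P(f_k)) to 0.  This is the vanishing of the
    capacity of bounded sets, in its form for translation increments, and it is
    what restricts the dimension to 1 and 2.  On the line, tents of width L
    have energy at most of order |x| min(1, |x| / L) ([vanishing_energy_dim1]).
    In the plane the energy of a tent is bounded only by a multiple of |x|^2,
    whatever its width, but tents of widths rho 2^k, k < N, have almost
    orthogonal increments, so that their average has energy at most of order
    |x|^2 / N ([vanishing_energy_dim2]).  Finally h = 1_A - f_k vanishes on A and
    P(A) - I_P(h) = I_P(f_k), so the infimum defining rigidity is 0. *)

(** * Lebesgue measure under affine maps *)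

Section lebesgue.
Context {R : realType}.
Notation lambda := (@lebesgue_measure R).

(** By uniqueness of Lebesgue measure it suffices to compare both sides on
    half-open intervals. *)
Lemma lebesgue_measure_affine (c a : R) (A : set R) : 0 < c -> measurable A ->
  (lambda ((fun t => c * t + a)%R @^-1` A) = (c^-1)%:E * lambda A)%E.
Proof.
move=> c0 mA.
pose g (t : measurableTypeR R) : measurableTypeR R := c * t + a.
have mg : measurable_fun setT g.
  by apply: measurable_funD => //; exact: measurable_funM.
(* [pushforward] is a measure only together with a proof of measurability;
   [mu' mg] supplies it. *)
pose mu' := mscale (NngNum (ltW c0)) (pushforward lambda g); pose mu := mu' mg.
have -> : (lambda A = mu A)%E.
  apply: lebesgue_measure_unique => //= _ [[x y]] _ <-.
  rewrite /mu /mu' /mscale/= /pushforward/=.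
  rewrite (_ : _ @^-1` _ = `](x - a) / c, (y - a) / c]%classic); last first.
    apply/seteqP; split=> t;
      by rewrite /= !in_itv/= ltr_pdivrMr// ler_pdivlMr// ltrBlDr lerBrDr mulrC.
  rewrite !lebesgue_measure_itv/= !lte_fin ltr_pM2r ?invr_gt0// ltrD2r.
  case: ifPn => _; last by rewrite mule0.
  rewrite -!EFinD -EFinM; congr EFin; field; exact: lt0r_neq0.
rewrite /mu /mu' /mscale/= muleA -EFinM mulVf ?mul1e//; exact: lt0r_neq0.
Qed.

Lemma rV_cons_affine n (c : R) (a : 'rV[R]_n.+1) (p : 'rV[R]_n * R) :
  c *: rV_cons p + a =
  rV_cons (c *: p.1 + (rsubmx (a : 'M[R]_(1, 1 + n))), c * p.2 + a ord0 ord0).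
Proof.
rewrite /rV_cons /=; apply/rowP => i; rewrite !mxE.
case: splitP => j /= ij; rewrite !mxE.
  by congr (_ + a _ _); apply/val_inj; rewrite /= ij ord1.
by congr (_ + a _ _); apply/val_inj; rewrite /= ij.
Qed.

Lemma measurable_affine n (c : R) (a : 'rV[R]_n) :
  measurable_fun setT (fun x : 'rV[R]_n => c *: x + a).
Proof.
apply: measurable_fun_rV => i.
under eq_fun do rewrite !mxE.
apply: measurable_funD => //; apply: measurable_funM => //.
exact: measurable_rV_coord.
Qed.

Lemma leb_consE n (B : set 'rV[R]_n.+1) :
  (leb n.+1 B = \int[leb n]_x lambda (xsection (@rV_cons R n @^-1` B) x))%E.
Proof. by []. Qed.

(** Dilations and translations are treated together because the induction on
    the dimension is the same: an affine map acts on the first coordinate,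
    where the one-dimensional case applies to each section, and on the
    remaining ones, where the induction hypothesis identifies the image
    measure. *)
Lemma leb_affine n (c : R) (a : 'rV[R]_n) (A : set 'rV[R]_n) :
  0 < c -> measurable A ->
  (leb n ((fun x : 'rV[R]_n => c *: x + a)%R @^-1` A) =
   ((c ^+ n)^-1)%:E * leb n A)%E.
Proof.
move=> c0; elim: n a A => [|n IH] a A mA.
  rewrite expr0 invr1 mul1e /=.
  congr dirac; apply/seteqP; split=> x /=; rewrite (_ : c *: x + a = x)//;
    apply/rowP => -[]//.
rewrite !leb_consE.
set B := @rV_cons R n @^-1` A.
have mB : measurable B.
  by rewrite -[X in measurable X]setTI; exact: measurable_rV_cons.
pose g1 (x : 'rV[R]_n) := c *: x + (rsubmx (a : 'M[R]_(1, 1 + n))).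
have mg1 : measurable_fun setT g1 by exact: measurable_affine.
pose h x := lambda (xsection B x).
have mh : measurable_fun setT h by exact: measurable_fun_xsection.
transitivity (\int[leb n]_x ((c^-1)%:E * h (g1 x)))%E.
  apply: eq_integral => x _.
  rewrite /h -(@lebesgue_measure_affine c (a ord0 ord0))//; last first.
    exact: measurable_xsection.
  congr (lambda _); apply/seteqP; split=> t;
    by rewrite /xsection/= !inE /B/= rV_cons_affine/=.
rewrite ge0_integralZl//;
  [|exact: measurableT_comp|by rewrite lee_fin invr_ge0 ltW].
rewrite (_ : \int[_]_x _ = \int[pushforward (leb n) g1]_x h x)%E; last first.
  by rewrite (ge0_integral_pushforward mg1).
pose k : {nonneg R} := NngNum (ltW (exprn_gt0 n c0)).
pose mu' := mscale k (pushforward (leb n) g1); pose mu := mu' mg1.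
transitivity ((c ^- n.+1)%:E * \int[leb n]_x h x)%E; last by [].
have -> : (\int[leb n]_x h x = \int[mu]_x h x)%E.
  apply: eq_measure_integral => X mX _.
  have E : leb n (g1 @^-1` X) = ((c ^- n)%:E * leb n X)%E by exact: IH.
  suff : leb n X = ((c ^+ n)%:E * leb n (g1 @^-1` X))%E by [].
  rewrite E muleA -EFinM mulfV ?mul1e//.
  by rewrite expf_neq0// gt_eqF.
rewrite /mu /mu' ge0_integral_mscale//= muleA -EFinM exprS invfM -mulrA.
rewrite mulVf ?mulr1//.
by rewrite expf_neq0// gt_eqF.
Qed.

Lemma rV_norm_lt n (x : 'rV[R]_n) (r : R) : 0 < r ->
  (`|x| < r) <-> (forall i, `|x ord0 i| < r).
Proof.
move=> r0; rewrite /Num.norm/= mx_normrE; split=> [/bigmax_ltP[_ h] i|h].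
  exact: (h (ord0, i)).
by apply/bigmax_ltP; split => // -[i j] _ /=; rewrite ord1; exact: h.
Qed.

(** The sigma-algebra is generated by the coordinates, so measurability of the
    sup norm is read off its expression as a finite maximum. *)
Lemma measurable_rV_norm n :
  measurable_fun setT (fun x : 'rV[R]_n => `|x|).
Proof.
rewrite (_ : (fun x => _) = (fun x : 'rV[R]_n =>
    \big[Num.max/0]_(ij <- index_enum [the finType of 'I_1 * 'I_n : Type])
      `|x ij.1 ij.2|)); last first.
  by apply/funext => x; rewrite /Num.norm/= mx_normrE.
elim: (index_enum _) => [|[i j] s IH].
  under eq_fun do rewrite big_nil; exact: measurable_cst.
under eq_fun do rewrite big_cons.
apply: measurable_maxr => //=; rewrite ord1.
apply: measurableT_comp => //; exact: measurable_rV_coord.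
Qed.

Definition cube n (r : R) : set 'rV[R]_n := [set x | `|x| < r].

Lemma measurable_cube n (r : R) : measurable (@cube n r).
Proof.
rewrite (_ : @cube n r = (fun x : 'rV[R]_n => `|x|) @^-1` `]-oo, r[%classic).
  rewrite -[X in measurable X]setTI; exact: measurable_rV_norm.
by apply/seteqP; split => x /=; rewrite in_itv.
Qed.

Lemma leb_cube n (r : R) : 0 < r ->
  leb n (@cube n r) = ((2 * r) ^+ n)%:E.
Proof.
move=> r0; elim: n => [|n IH].
  rewrite /= diracE expr0 (_ : _ \in _ = true)//; apply/mem_set => /=.
  by apply/rV_norm_lt => // -[].
rewrite leb_consE.
pose I := `](- r), r[%classic.
have IE t : I t <-> `|t| < r by rewrite /I/= in_itv/= ltr_norml.
transitivity ((leb n \x lambda) (@cube n r `*` I))%E.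
  apply: eq_integral => x _; congr (lambda (xsection _ x)).
  apply/seteqP; split => -[y t] /=.
    move/(rV_norm_lt _ r0) => h; split.
      apply/rV_norm_lt => // i.
      by have := h (rshift 1 i); rewrite (row_mxEr (const_mx t : 'rV[R]_1)).
    have := h (lshift n (ord0 : 'I_1)).
    by rewrite (row_mxEl (const_mx t : 'rV[R]_1)) mxE => ht; apply/IE.
  case=> /(rV_norm_lt _ r0) h /IE tr.
  apply/(rV_norm_lt _ r0) => i; rewrite /rV_cons mxE.
  by case: splitP => j _ //; rewrite mxE.
rewrite product_measure1E; [|exact: measurable_cube|exact: measurable_itv].
have lI : lambda I = (2 * r)%:E.
  by rewrite lebesgue_measure_itv/= lte_fin gtrN// opprK mulr2n mulrDl mul1r.
by rewrite exprSr EFinM -IH -lI.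
Qed.

End lebesgue.
Arguments cube {R n} r.

(** * Bounded functions with bounded support *)

Section boxed.
Context {R : realType} {n : nat}.
Implicit Types (f g : 'rV[R]_n -> R) (x y : 'rV[R]_n) (M r : R).

Lemma measurable_addl x : measurable_fun setT (fun y : 'rV[R]_n => x + y).
Proof.
have := @measurable_affine R n 1 x.
by congr measurable_fun; apply/funext => y; rewrite scale1r addrC.
Qed.

Lemma leb_translation x (A : set 'rV[R]_n) : measurable A ->
  leb n ((fun y => x + y) @^-1` A) = leb n A.
Proof.
move=> mA; have := @leb_affine R n 1 x A ltr01 mA.
rewrite expr1n invr1 mul1e => <-; congr (leb n _).
by apply/seteqP; split=> y; rewrite /= scale1r addrC.
Qed.

Lemma ge0_integral_translation x (h : 'rV[R]_n -> \bar R) :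
  measurable_fun setT h -> (forall y, (0 <= h y)%E) ->
  (\int[leb n]_y h (x + y)%R = \int[leb n]_y h y)%E.
Proof.
move=> mh h0.
transitivity (\int[pushforward (leb n) (fun y => x + y)%R]_y h y)%E.
  by rewrite (ge0_integral_pushforward (measurable_addl x)).
apply: eq_measure_integral; first exact: measurable_addl.
by move=> mx A mA _; exact: (leb_translation x mA).
Qed.

(** Test functions with explicit constants; [cube] and the sup norm are used
    rather than Euclidean balls because the volume of a cube is explicit. *)
Definition boxed M r f := [/\ measurable_fun setT f,
  forall x, `|f x| <= M & forall x, r <= `|x| -> f x = 0].

Lemma boxed_test M r f : boxed M r f -> test_function f.
Proof.
move=> [mf fM fr]; split => //.
  exists M; split; first exact: num_real.
  by move=> t Mt x _; exact: le_trans (fM x) (ltW Mt).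
apply: bounded_closed_compact; last exact: closed_closure.
exists r; split; first exact: num_real.
move=> t rt x xS.
have cl : closed [set y : 'rV[R]_n | `|y| <= t].
  rewrite (_ : [set _ | _] = Num.norm @^-1` [set u : R | u <= t])//.
  apply: closed_comp; last exact: closed_le.
  by move=> y _; exact: norm_continuous.
rewrite closureE in xS; apply: xS; split=> // y /= fy.
rewrite leNgt; apply/negP => ty.
by move/eqP: fy; apply; apply: fr; apply: ltW; exact: lt_trans rt ty.
Qed.

Lemma locally_finite_cube (mu : {measure set 'rV[R]_n -> \bar R}) r :
  locally_finite mu -> (mu (cube r) < +oo)%E.
Proof.
move=> lf; apply: lf; first exact: measurable_cube.
exists r; split; first exact: num_real.
by move=> t rt x /= xr; exact: ltW (lt_trans xr rt).
Qed.

Lemma boxed_le_indic M r f : boxed M r f -> forall x,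
  `|f x| <= M * \1_(cube r) x.
Proof.
move=> [_ fM fr] x; rewrite indicE; case: (ltP `|x| r) => xr.
  by rewrite mem_set// mulr1.
by rewrite memNset ?mulr0 ?fr ?normr0//=; apply/negP; rewrite -leNgt.
Qed.

Lemma boxed_indic r (B : set 'rV[R]_n) :
  measurable B -> B `<=` cube r -> boxed 1 r (\1_B).
Proof.
move=> mB Br; split.
- exact: measurable_indic.
- by move=> x; rewrite indicE; case: (_ \in _); rewrite ?normr1 ?normr0.
- move=> x rx; rewrite indicE memNset// => /Br; rewrite /cube/=.
  by apply/negP; rewrite -leNgt.
Qed.

Lemma boxed_integrable (mu : {measure set 'rV[R]_n -> \bar R}) M r f :
  locally_finite mu -> boxed M r f -> mu.-integrable setT (EFin \o f).
Proof.
move=> lf bf; have [mf _ _] := bf.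
apply: (@le_integrable _ _ _ mu _ measurableT _
  (EFin \o (fun x => M * \1_(cube r) x))).
- exact/measurable_EFinP.
- move=> x _ /=; rewrite lee_fin; apply: le_trans (boxed_le_indic bf x) _.
  exact: ler_norm.
- apply: (@integrableZl _ _ _ mu _ measurableT M (EFin \o \1_(cube r))).
  have mr : measurable (@cube R n r) := @measurable_cube R n r.
  apply/integrableP; split; first exact/measurable_EFinP.
  under eq_integral do rewrite /= ger0_norm//.
  by rewrite integral_indic// setIT; exact: locally_finite_cube.
Qed.

Lemma leb_locally_finite : locally_finite (leb n : set 'rV[R]_n -> \bar R).
Proof.
move=> A mA [M [_ AM]].
pose r := Num.max (M + 2) 1.
have r0 : 0 < r by rewrite lt_max ltr01 orbT.
have : A `<=` cube r.
  move=> x Ax; rewrite /cube/=.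
  apply: (@le_lt_trans _ _ (M + 1)); first by apply: (AM (M + 1)) => //; lra.
  by rewrite /r lt_max; apply/orP; left; lra.
move=> Ar; apply: (@le_lt_trans _ _ (leb n (cube r))).
  by apply: le_measure; rewrite ?inE//; exact: measurable_cube.
by rewrite leb_cube// ltry.
Qed.

Lemma sigma_finite_locally_finite (mu : {measure set 'rV[R]_n -> \bar R}) :
  locally_finite mu -> sigma_finite setT mu.
Proof.
move=> lf; exists (fun k => cube k%:R).
  apply/seteqP; split => // x _; exists (Num.bound `|x|) => //=.
  by rewrite /cube/=; exact: archi_boundP.
by move=> k; split; [exact: measurable_cube|exact: locally_finite_cube].
Qed.

Definition bounded_support f := exists M r, boxed M r f.

Lemma bounded_support_integrable f : bounded_support f ->
  (leb n).-integrable setT (EFin \o f).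
Proof. by move=> [M [r /(boxed_integrable leb_locally_finite)]]. Qed.

Lemma bounded_supportD f g : bounded_support f -> bounded_support g ->
  bounded_support (fun y => f y + g y).
Proof.
move=> [M [r [mf fM fr]]] [M' [r' [mg gM gr]]]; exists (M + M'), (Num.max r r').
split; first exact: measurable_funD.
- by move=> y; rewrite (le_trans (ler_normD _ _))// lerD.
- by move=> y; rewrite ge_max => /andP[ry r'y]; rewrite fr// gr// addr0.
Qed.

Lemma bounded_supportM f g : bounded_support f -> bounded_support g ->
  bounded_support (fun y => f y * g y).
Proof.
move=> [M [r [mf fM fr]]] [M' [r' [mg gM gr]]]; exists (M * M'), r.
split; first exact: measurable_funM.
- by move=> y; rewrite normrM ler_pM.
- by move=> y ry; rewrite fr// mul0r.
Qed.

Lemma bounded_supportZ (c : R) f : bounded_support f ->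
  bounded_support (fun y => c * f y).
Proof.
move=> [M [r [mf fM fr]]]; exists (`|c| * M), r.
split; first exact: measurable_funM.
- by move=> y; rewrite normrM ler_wpM2l.
- by move=> y ry; rewrite fr// mulr0.
Qed.

Lemma bounded_support_norm f : bounded_support f ->
  bounded_support (fun y => `|f y|).
Proof.
move=> [M [r [mf fM fr]]]; exists M, r; split.
- exact: measurableT_comp.
- by move=> y; rewrite normr_id.
- by move=> y ry; rewrite fr// normr0.
Qed.

Lemma bounded_support_shift x f : bounded_support f ->
  bounded_support (fun y => f (x + y)).
Proof.
move=> [M [r [mf fM fr]]]; exists M, (r + `|x|); split => //.
- by apply: measurableT_comp => //; exact: measurable_addl.
- move=> y ry; apply: fr; rewrite -(addKr x y) in ry.
  have := ler_normD (- x) (x + y); rewrite normrN => h; lra.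
Qed.

Lemma bounded_support_sqr f :
  bounded_support f -> bounded_support (fun y => f y ^+ 2).
Proof. by move=> bf; exact: (bounded_supportM bf bf). Qed.

Lemma boxed_mul_shift M r f x : boxed M r f ->
  boxed (M * M) r (fun y => f y * f (x + y)).
Proof.
move=> [mf fM fr]; split.
- apply: measurable_funM => //; apply: measurableT_comp => //.
  exact: measurable_addl.
- by move=> y; rewrite normrM ler_pM.
- by move=> y ry; rewrite fr// mul0r.
Qed.

Lemma measurable_mul_shift M r f : boxed M r f ->
  measurable_fun setT (fun z : 'rV[R]_n * 'rV[R]_n => f z.2 * f (z.1 + z.2)).
Proof.
move=> [mf _ _]; apply: measurable_funM; first exact: measurableT_comp.
apply: (measurableT_comp mf); apply: measurable_fun_rV => i.
under eq_fun do rewrite mxE.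
apply: measurable_funD; apply: (measurableT_comp (measurable_rV_coord i)) => //.
Qed.

End boxed.

(** * Autocorrelation and variance *)

(** Fubini for measures whose sigma-finiteness is a hypothesis rather than a
    structure: the two parts of a correlation measure are only known to be
    finite under the moment assumption, and [leb] is a plain measure. *)
Lemma fubini_finite_left d1 d2 (T1 : measurableType d1) (T2 : measurableType d2)
  (R : realType) (m1 : {measure set T1 -> \bar R})
  (m2 : {measure set T2 -> \bar R}) (f : T1 * T2 -> \bar R) (K : R) :
  (m1 setT < +oo)%E -> sigma_finite setT m2 -> measurable_fun setT f ->
  (forall x, \int[m2]_y `|f (x, y)| <= K%:E)%E ->
  [/\ (\int[m1]_x \int[m2]_y f (x, y) = \int[m2]_y \int[m1]_x f (x, y))%E,
      m1.-integrable setT (fun x => \int[m2]_y f (x, y))%E &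
      m2.-integrable setT (fun y => \int[m1]_x f (x, y))%E].
Proof.
move=> m1oo s2 mf fK.
have s1 : sigma_finite setT m1.
  by apply: fin_num_fun_sigma_finite; rewrite ?measure0//; apply/lty_fin_num_fun.
pose n1 := HB.pack_for (SigmaFiniteMeasure.type T1 R) (Measure.sort m1)
  (isSFinite.Build _ _ _ _ (sfinite_measure_sigma_finite s1))
  (isSigmaFinite.Build _ _ _ _ s1).
pose n2 := HB.pack_for (SigmaFiniteMeasure.type T2 R) (Measure.sort m2)
  (isSFinite.Build _ _ _ _ (sfinite_measure_sigma_finite s2))
  (isSigmaFinite.Build _ _ _ _ s2).
have mfa : measurable_fun setT (abse \o f) by exact: measurableT_comp.
have fi : (\int[n1]_x \int[n2]_y `|f (x, y)| < +oo)%E.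
  apply: (@le_lt_trans _ _ (\int[n1]_x (cst K%:E) x)%E).
    apply: ge0_le_integral => //.
    - by move=> x _; exact: integral_ge0.
    - exact: (measurable_fun_fubini_tonelli_F (m2 := n2) (abse \o f) mfa
        (fun=> abse_ge0 _)).
  by rewrite integral_cst// ltey_eq fin_numM//; exact: (lty_fin_num_fun m1oo).
have fi' : ((n1 \x n2)%E).-integrable setT f by apply/integrable12ltyP.
split.
- exact: (Fubini fi').
- exact: (integrable_fubini_F fi').
- pose g (z : T2 * T1) := f (z.2, z.1).
  have mg : measurable_fun setT g.
    apply: (measurableT_comp mf); exact: measurable_fun_pair.
  have gi : ((n2 \x n1)%E).-integrable setT g.
    by apply/(integrable12ltyP n2 n1 mg)/(integrable21ltyP n1 n2 mf).
  exact: (integrable_fubini_F gi).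
Qed.

Section autocorrelation.
Context {R : realType} {n : nat}.
Implicit Types (f : 'rV[R]_n -> R) (x y : 'rV[R]_n) (M r : R).

Definition increment x f y : R := f (x + y) - f y.

Definition energy f x : R := \int[leb n]_y (increment x f y ^+ 2).

Definition autocorr f x : R := \int[leb n]_y (f y * f (x + y)).

(** The correlation formula integrates in the order dx dy; exchanging the
    order produces the autocorrelation.  The integrand is dominated by
    [M * M] on a bounded set of [y], uniformly in [x]. *)
Lemma fubini_autocorr (nu : {measure set 'rV[R]_n -> \bar R}) M r f :
  (nu setT < +oo)%E -> boxed M r f ->
  [/\ (\int[nu]_x (autocorr f x)%:E =
       \int[leb n]_y (\int[nu]_x (f y * f (x + y)))%:E)%E,
      nu.-integrable setT (EFin \o autocorr f) &
      (leb n).-integrable setT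
        (EFin \o (fun y => \int[nu]_x (f y * f (x + y))))].
Proof.
move=> nuoo bf.
pose F (z : 'rV[R]_n * 'rV[R]_n) := (f z.2 * f (z.1 + z.2))%:E.
have mF : measurable_fun setT F.
  by apply/measurable_EFinP; exact: measurable_mul_shift bf.
have Fx x : (\int[leb n]_y F (x, y) = (autocorr f x)%:E)%E.
  rewrite /autocorr /Rintegral fineK//.
  apply: integrable_fin_num => //.
  apply: (boxed_integrable leb_locally_finite (boxed_mul_shift x bf)).
have mf : measurable_fun setT f by case: bf.
have Fy y : (\int[nu]_x F (x, y) = (\int[nu]_x (f y * f (x + y)))%:E)%E.
  rewrite /Rintegral fineK//.
  apply: integrable_fin_num => //.
  apply: measurable_bounded_integrable => //.
    apply: measurable_funM => //; apply: measurableT_comp => //.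
    by under eq_fun do rewrite addrC; exact: measurable_addl.
  exists (M * M); split; first exact: num_real.
  move=> t Mt x _; apply: le_trans (ltW Mt).
  by case: (boxed_mul_shift x bf) => _ + _; apply.
have lf := @leb_locally_finite R n.
have s2 : sigma_finite setT (leb n : set 'rV[R]_n -> \bar R).
  exact: sigma_finite_locally_finite.
pose g (y : 'rV[R]_n) := M * M * \1_(cube r) y.
have bg : boxed (M * M) r g.
  have M2 : 0 <= M * M by rewrite -expr2 sqr_ge0.
  split.
  - apply: measurable_funM => //; apply: measurable_indic.
    exact: measurable_cube.
  - move=> y; rewrite /g normrM ger0_norm// ler_piMr// indicE.
    by case: (_ \in _); rewrite ?normr1 ?normr0.
  - move=> y ry; rewrite /g indicE memNset ?mulr0//=.
    by apply/negP; rewrite -leNgt.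
have [x|E1 E2 E3] := @fubini_finite_left _ _ _ _ _ nu (leb n) F
  (\int[leb n]_y g y) nuoo s2 mF.
  rewrite /Rintegral fineK; last exact: integrable_fin_num (boxed_integrable lf bg).
  apply: ge0_le_integral => //=.
  - by do 2 apply: measurableT_comp => //; case: (boxed_mul_shift x bf).
  - by apply: measurableT_comp => //; case: bg.
  - by move=> y _; rewrite lee_fin; exact: (boxed_le_indic (boxed_mul_shift x bf)).
split.
- rewrite -(eq_integral _ _ (fun x _ => Fx x)) E1.
  by apply: eq_integral => y _; rewrite Fy.
- by move: E2; congr (integrable _ _ _); apply/funext => x; rewrite Fx.
- by move: E3; congr (integrable _ _ _); apply/funext => y; rewrite Fy.
Qed.
End autocorrelation.

Section energy.
Context {R : realType} {n : nat}.
Implicit Types (f : 'rV[R]_n -> R) (x y : 'rV[R]_n) (M r : R).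

(** Expand the square; by translation invariance the two squares have the same
    integral. *)
Lemma autocorr_energy M r f x : boxed M r f ->
  autocorr f 0 - autocorr f x = 2^-1 * energy f x.
Proof.
rewrite /energy /increment.
move=> bf; have [mf fM fr] := bf.
have lf := @leb_locally_finite R n.
have i0 : (leb n).-integrable setT (EFin \o (fun y => f y ^+ 2)).
  have := boxed_integrable lf (boxed_mul_shift 0 bf).
  by congr integrable; apply/funext => y /=; rewrite add0r expr2.
have mx : measurable_fun setT (fun y => f (x + y)).
  by apply: measurableT_comp => //; exact: measurable_addl.
have ix := boxed_integrable lf (boxed_mul_shift x bf).
have m2 : measurable_fun setT (fun y => (f y ^+ 2)%:E).
  by apply: measurableT_comp => //; exact: measurable_funX.
have E : (\int[leb n]_y (f (x + y) ^+ 2)%:E = \int[leb n]_y (f y ^+ 2)%:E)%E.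
  rewrite (ge0_integral_translation x m2)// => y.
  by rewrite lee_fin sqr_ge0.
have it : (leb n).-integrable setT (EFin \o (fun y => f (x + y) ^+ 2)).
  apply/integrableP; split.
    by apply: measurableT_comp => //; exact: measurable_funX.
  under eq_integral do rewrite /= ger0_norm ?sqr_ge0//.
  rewrite E; case/integrableP: i0 => _.
  by under eq_integral do rewrite /= ger0_norm ?sqr_ge0//.
have -> : \int[leb n]_y ((f (x + y) - f y) ^+ 2) =
    \int[leb n]_y (f (x + y) ^+ 2 + (f y ^+ 2 - 2 * (f y * f (x + y)))).
  by apply: eq_Rintegral => y _; ring.
have i2 : (leb n).-integrable setT (EFin \o (fun y => 2 * (f y * f (x + y)))).
  exact: (@integrableZl _ _ _ (leb n) _ measurableT 2
    (EFin \o (fun y => f y * f (x + y)))).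
rewrite RintegralD//; last exact: (@integrableB _ _ _ (leb n) _ measurableT
  (EFin \o (fun y => f y ^+ 2)) (EFin \o (fun y => 2 * (f y * f (x + y))))).
rewrite RintegralB// RintegralZl//.
have -> : \int[leb n]_y (f (x + y) ^+ 2) = autocorr f 0.
  rewrite /Rintegral E /autocorr; congr fine; apply: eq_integral => y _.
  by rewrite add0r expr2.
have -> : \int[leb n]_y (f y ^+ 2) = autocorr f 0.
  by rewrite /autocorr; apply: eq_Rintegral => y _; rewrite add0r expr2.
rewrite -/(autocorr f x); by field.
Qed.

Context (C : signed_radon R n).
Context (pos_finite : (spos C setT < +oo)%E).
Context (neg_finite : (sneg C setT < +oo)%E).

Context {d' : measure_display} {Omega : measurableType d'}.
Context (Pr : probability Omega R) (P : R.-ker Omega ~> 'rV[R]_n).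
Context (PC : correlation_measure Pr P C).

Lemma npoints_linear_stat w (A : set 'rV[R]_n) : measurable A ->
  npoints P A w = linear_stat P (\1_A) w.
Proof.
by move=> mA; rewrite /npoints /linear_stat /Rintegral integral_indic ?setIT.
Qed.

Lemma variance_linear_stat M r f : boxed M r f ->
  'V_Pr[linear_stat P f] = (signed_integral C (autocorr f))%:E.
Proof.
move=> bf; rewrite /variance PC; [|exact: boxed_test bf|exact: boxed_test bf].
have [Ep ip jp] := fubini_autocorr pos_finite bf.
have [En in' jn] := fubini_autocorr neg_finite bf.
rewrite /signed_integral EFinB.
rewrite /Rintegral !fineK;
  [|exact: integrable_fin_num|exact: integrable_fin_num].
by rewrite Ep En -integralB_EFin.
Qed.

(** Zero total mass allows [autocorr f 0] to be subtracted under the integral.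
    As [autocorr f] is maximal at 0, the positive part then contributes a
    nonpositive term, and the negative part the integral of half the
    energy. *)
Lemma variance_le_energy M r f (g : 'rV[R]_n -> R) :
  spos C setT = sneg C setT -> boxed M r f ->
  (sneg C).-integrable setT (EFin \o g) ->
  (forall x, energy f x <= g x) ->
  ('V_Pr[linear_stat P f] <= \int[sneg C]_x (g x)%:E)%E.
Proof.
move=> C0 bf ig fg; rewrite (variance_linear_stat bf) /signed_integral.
have [_ ip _] := fubini_autocorr pos_finite bf.
have [_ in' _] := fubini_autocorr neg_finite bf.
have c0 x : 2 * (autocorr f 0 - autocorr f x) <= g x.
  by rewrite (autocorr_energy x bf) mulrA mulfV// mul1r.
have c1 x : autocorr f x <= autocorr f 0.
  rewrite -subr_ge0 (autocorr_energy x bf) mulr_ge0//.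
  by apply: Rintegral_ge0 => y _; rewrite sqr_ge0.
have icst (mu : {measure set 'rV[R]_n -> \bar R}) (k : R) : (mu setT < +oo)%E ->
    mu.-integrable setT (EFin \o cst k).
  move=> h; apply: measurable_bounded_integrable => //.
  exists `|k|; split; first exact: num_real.
  by move=> t kt x _; exact: ltW.
have H1 : \int[spos C]_x autocorr f x <= \int[spos C]_x cst (autocorr f 0) x.
  by apply: le_Rintegral => //; exact: icst.
have H2 : \int[sneg C]_x (cst (autocorr f 0) x - autocorr f x) <=
    \int[sneg C]_x g x.
  apply: le_Rintegral => // [|x _].
    exact: (@integrableB _ _ _ (sneg C) _ measurableT _ _
      (icst _ _ neg_finite) in').
  apply: le_trans (c0 x) => /=; have := c1 x; lra.
rewrite RintegralB// in H2; last exact: icst.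
rewrite -[leRHS]fineK; last exact: integrable_fin_num.
rewrite lee_fin; apply: le_trans H2; rewrite lerD2r.
by apply: le_trans H1 _; rewrite !Rintegral_cst// C0.
Qed.
End energy.

(** * Euclidean balls and the total mass of the correlation measure *)

Section balls.
Context {R : realType} {n : nat}.
Implicit Types (x y : 'rV[R]_n) (r a : R).

Lemma enorm_ge0 x : 0 <= enorm x.
Proof. exact: sqrtr_ge0. Qed.

Lemma measurable_enorm : measurable_fun setT (@enorm R n).
Proof.
apply: measurableT_comp.
  by apply: continuous_measurable_fun; exact: sqrt_continuous.
apply: measurable_sum => i; apply: measurable_funX.
exact: measurable_rV_coord.
Qed.

Lemma measurable_enormX k :
  measurable_fun setT (fun t : 'rV[R]_n => (enorm t ^+ k)%:E).
Proof.
by apply: measurableT_comp => //; apply: measurable_funX; exact: measurable_enorm.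
Qed.

Lemma measurable_eball r : measurable (@eball R n r).
Proof.
rewrite (_ : eball r = @enorm R n @^-1` `]-oo, r[%classic).
  by rewrite -[X in measurable X]setTI; exact: measurable_enorm.
by apply/seteqP; split => x /=; rewrite in_itv.
Qed.

Lemma enorm_lt x r : 0 < r -> (enorm x < r) = (\sum_i x ord0 i ^+ 2 < r ^+ 2).
Proof.
move=> r0; rewrite -[in RHS](sqr_sqrtr (_ : 0 <= \sum_i x ord0 i ^+ 2)).
  by rewrite ltr_pXn2r// ?nnegrE ?sqrtr_ge0// ltW.
by apply: sumr_ge0 => i _; exact: sqr_ge0.
Qed.

Lemma norm_le_enorm x : `|x| <= enorm x.
Proof.
rewrite [leLHS]/Num.norm/= mx_normrE; apply/bigmax_leP; split; first exact: enorm_ge0.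
move=> [i j] _ /=; rewrite ord1 /enorm -sqrtr_sqr ler_wsqrtr//.
rewrite (bigD1 j)//= lerDl; apply: sumr_ge0 => k _; exact: sqr_ge0.
Qed.

Lemma eball_cube r : @eball R n r `<=` cube r.
Proof. by move=> x; rewrite /eball /cube/=; exact: le_lt_trans (norm_le_enorm x). Qed.

Lemma boxed_eball r : boxed 1 r (\1_(@eball R n r)).
Proof. by apply: boxed_indic; [exact: measurable_eball|exact: eball_cube]. Qed.

Lemma enorm_scale r x : 0 <= r -> enorm (r *: x) = r * enorm x.
Proof.
move=> r0; rewrite /enorm -[in RHS](ger0_norm r0) -sqrtr_sqr -sqrtrM ?sqr_ge0//.
by congr Num.sqrt; rewrite mulr_sumr; apply: eq_bigr => i _; rewrite mxE exprMn.
Qed.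

Definition ball_volume : R := fine (leb n (@eball R n 1)).

Lemma leb_eball r : 0 < r -> leb n (@eball R n r) = (r ^+ n * ball_volume)%:E.
Proof.
move=> r0; have := @leb_affine R n r 0 (eball r) r0 (measurable_eball r).
rewrite (_ : _ @^-1` _ = eball 1); last first.
  have H x : (r * enorm x < r) = (enorm x < 1) by rewrite gtr_pMr.
  by apply/seteqP; split=> x; rewrite /eball/= addr0 enorm_scale ?ltW// H.
rewrite EFinM /ball_volume fineK; last first.
  rewrite ge0_fin_numE//; apply: leb_locally_finite; first exact: measurable_eball.
  exists 1; split; first exact: num_real.
  by move=> t t1 x /eball_cube; rewrite /cube/= => x1; exact: ltW (lt_trans x1 t1).
move=> ->; rewrite muleA -EFinM mulfV ?mul1e//.
by rewrite expf_neq0// gt_eqF.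
Qed.

Lemma ball_volume_gt0 : 0 < ball_volume.
Proof.
pose s : R := n.+1%:R^-1.
have s0 : 0 < s by rewrite invr_gt0.
have cs : @cube R n s `<=` eball 1.
  move=> x; rewrite /cube/= => /(rV_norm_lt _ s0) xs.
  rewrite /eball/= enorm_lt// expr1n.
  apply: (@le_lt_trans _ _ (\sum_(i < n) s)).
    apply: ler_sum => i _; rewrite -real_normK ?num_real//.
    rewrite expr2 -[leRHS]mulr1 ler_pM// ltW//.
    by apply: lt_le_trans (xs i) _; rewrite invf_le1// ler1n.
  by rewrite sumr_const card_ord -mulr_natl ltr_pdivrMr// mul1r ltr_nat.
rewrite -lte_fin -(mul1r ball_volume) -(expr1n _ n) -leb_eball//.
apply: (@lt_le_trans _ _ (leb n (@cube R n s))).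
  by rewrite leb_cube// lte_fin exprn_gt0// mulr_gt0.
by apply: le_measure; rewrite ?inE//; [exact: measurable_cube|exact: measurable_eball].
Qed.

(** The triangle inequality for the Euclidean norm; it bounds the overlap of two
    translates of a ball from below. *)
Lemma eball_shift x r a : 0 < a -> a < r -> enorm x <= a ->
  eball (r - a) `<=` (fun y => x + y) @^-1` eball r.
Proof.
move=> a0 ar xa y; rewrite /eball/= !enorm_lt ?subr_gt0//; last exact: lt_trans ar.
have ra : 0 < r - a by rewrite subr_gt0.
have r0 : 0 < r by exact: lt_trans ar.
move=> yr.
have xa2 : \sum_i x ord0 i ^+ 2 <= a ^+ 2.
  rewrite -[leLHS]sqr_sqrtr ?ler_pXn2r ?nnegrE ?sqrtr_ge0 ?(ltW a0)//.
  by apply: sumr_ge0 => i _; exact: sqr_ge0.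
(* The square is convex: apply it with weights [a / r] and [(r - a) / r]; the
   two bounds then add up to exactly [r ^+ 2]. *)
apply: (@le_lt_trans _ _ (\sum_i (r / a * x ord0 i ^+ 2 +
    r / (r - a) * y ord0 i ^+ 2))).
  apply: ler_sum => i _; rewrite mxE.
  set u := x _ _; set v := y _ _.
  rewrite -subr_ge0 (_ : _ - _ = ((r - a) * u - a * v) ^+ 2 / (a * (r - a))).
    by rewrite divr_ge0 ?sqr_ge0// mulr_ge0// ltW.
  by field; rewrite !gt_eqF.
rewrite big_split/= -!mulr_sumr.
rewrite (_ : r ^+ 2 = r / a * a ^+ 2 + r / (r - a) * (r - a) ^+ 2); last first.
  by field; rewrite !gt_eqF.
by rewrite ler_ltD// ?ler_pM2l ?ltr_pM2l// divr_gt0.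
Qed.

End balls.

Section hyperuniformity.
Context {R : realType} {n : nat}.
Implicit Types (x y : 'rV[R]_n) (r a : R).

Lemma measurable_eball_overlap r x :
  measurable (eball r `&` (fun y => x + y) @^-1` @eball R n r).
Proof.
apply: measurableI; first exact: measurable_eball.
rewrite -[X in measurable X]setTI; apply: measurable_addl => //.
exact: measurable_eball.
Qed.

Lemma autocorr_eball r x :
  (autocorr (\1_(eball r)) x)%:E =
  leb n (eball r `&` (fun y => x + y) @^-1` @eball R n r).
Proof.
have mI := measurable_eball_overlap r x.
rewrite /autocorr /Rintegral.
rewrite (_ : (\int[_]_y _)%E =
   leb n (eball r `&` (fun y => x + y) @^-1` @eball R n r)).
  rewrite fineK// ge0_fin_numE//.
  apply: le_lt_trans (locally_finite_cube r (@leb_locally_finite R n)).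
  apply: le_measure; rewrite ?inE//; first exact: measurable_cube.
  by move=> y [+ _]; exact: eball_cube.
pose I := eball r `&` (fun y => x + y) @^-1` @eball R n r.
transitivity (\int[leb n]_y (\1_I y)%:E)%E; last by rewrite integral_indic ?setIT.
by apply: eq_integral => y _; rewrite indicI.
Qed.

(** The proportion of the ball of radius [r] that stays in it after a
    translation by [x]. *)
Definition overlap r x : R :=
  autocorr (\1_(eball r)) x / (r ^+ n * @ball_volume R n).

Lemma overlap_ge0 r x : 0 < r -> 0 <= overlap r x.
Proof.
move=> r0; rewrite divr_ge0//; first by rewrite -lee_fin autocorr_eball.
by rewrite ltW// mulr_gt0 ?exprn_gt0 ?ball_volume_gt0.
Qed.

Lemma overlap_le1 r x : 0 < r -> overlap r x <= 1.
Proof.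
move=> r0; rewrite /overlap ler_pdivrMr ?mul1r; last first.
  by rewrite mulr_gt0 ?exprn_gt0 ?ball_volume_gt0.
rewrite -lee_fin autocorr_eball -leb_eball//.
apply: le_measure; rewrite ?inE.
- exact: measurable_eball_overlap.
- exact: measurable_eball.
- by move=> y [].
Qed.

Lemma overlap_ge r a x : 0 < a -> a < r -> enorm x <= a ->
  (1 - a / r) ^+ n <= overlap r x.
Proof.
move=> a0 ar xa; have r0 : 0 < r by exact: lt_trans ar.
rewrite /overlap ler_pdivlMr; last first.
  by rewrite mulr_gt0 ?exprn_gt0 ?ball_volume_gt0.
rewrite mulrA -exprMn (_ : (1 - a / r) * r = r - a); last first.
  by rewrite mulrBl mul1r divfK// gt_eqF.
rewrite -lee_fin autocorr_eball -leb_eball ?subr_gt0//.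
apply: le_measure; rewrite ?inE.
- exact: measurable_eball.
- exact: measurable_eball_overlap.
- move=> y yra; split; last exact: eball_shift yra.
  by move: yra; rewrite /eball/= => /lt_trans; apply; rewrite ltrBlDr ltrDl.
Qed.

Lemma overlap_cvg x : overlap k.+1%:R x @[k --> \oo] --> (1 : R).
Proof.
pose a := enorm x + 1.
have a0 : 0 < a by rewrite ltr_wpDl// enorm_ge0.
have c0 : 1 - a * harmonic k @[k --> \oo] --> (1 : R).
  rewrite -[X in _ --> X](subr0 (1 : R)); apply: cvgB; first exact: cvg_cst.
  by rewrite -[X in _ --> X](mulr0 a); apply: cvgMr; exact: cvg_harmonic.
have lb : (1 - a * harmonic k) ^+ n @[k --> \oo] --> (1 : R).
  rewrite -[X in _ --> X](expr1n _ n).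
  exact: (cvg_comp _ _ c0 (@exprn_continuous R n 1)).
apply: (squeeze_cvgr _ lb (cvg_cst (1 : R))).
near=> k.
rewrite overlap_le1// andbT; apply: overlap_ge => //; last by rewrite /a lerDl.
near: k; exists (Num.bound a) => // k /= ak.
apply: lt_le_trans (archi_boundP (ltW a0)) _.
by rewrite ler_nat; exact: leqW.
Unshelve. all: by end_near. Qed.

(** Dominated convergence; the overlap is at most 1, which is integrable because
    [mu] is finite. *)
Lemma overlap_integral_cvg (mu : {measure set 'rV[R]_n -> \bar R}) :
  (mu setT < +oo)%E ->
  \int[mu]_x overlap k.+1%:R x @[k --> \oo] --> fine (mu setT).
Proof.
move=> muoo.
have iov k : mu.-integrable setT (EFin \o overlap k.+1%:R).
  have [_ + _] := fubini_autocorr muoo (@boxed_eball R n k.+1%:R).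
  move/(integrableZr measurableT (k.+1%:R ^+ n * @ball_volume R n)^-1).
  by [].
have i1 : mu.-integrable setT (EFin \o cst (1 : R)).
  apply: measurable_bounded_integrable => //.
  exists 1; split; first exact: num_real.
  by move=> t t1 x _ /=; rewrite normr1; exact: ltW.
have [||_ _ H] := @dominated_convergence _ _ _ mu _ measurableT
  (fun k => EFin \o overlap k.+1%:R) (EFin \o cst (1 : R)) (EFin \o cst (1 : R))
  (fun k => measurable_int _ (iov k)) (measurable_int _ i1) _ i1.
- apply: aeW => x _ /=; apply: cvg_EFin; first exact: nearW.
  exact: overlap_cvg.
- apply: aeW => x k _ /=; rewrite lee_fin ger0_norm ?overlap_ge0//.
  exact: overlap_le1.
apply: fine_cvg; rewrite fineK; last exact: (lty_fin_num_fun muoo).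
have -> : mu setT = (\int[mu]_x ((EFin \o cst (1%R : R)) x))%E. 
  by rewrite -[LHS]mul1e -integral_cst.
exact: H.
Qed.

Context (C : signed_radon R n).
Context (pos_finite : (spos C setT < +oo)%E).
Context (neg_finite : (sneg C setT < +oo)%E).

Context {d' : measure_display} {Omega : measurableType d'}.
Context (Pr : probability Omega R) (P : R.-ker Omega ~> 'rV[R]_n).
Context (PC : correlation_measure Pr P C).

(** The normalised number variance is the integral of [overlap r] against the
    correlation measure, and [overlap r] tends to 1, boundedly, as [r] grows. *)
Lemma hyperuniform_total_mass : hyperuniform Pr P -> spos C setT = sneg C setT.
Proof.
move=> hP.
have e r : 0 < r -> ('V_Pr[npoints P (eball r)] / leb n (eball r))%E =
    (\int[spos C]_x overlap r x - \int[sneg C]_x overlap r x)%:E.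
  move=> r0.
  rewrite (_ : npoints P (eball r) = linear_stat P (\1_(eball r))); last first.
    by apply/funext => w; apply: npoints_linear_stat; exact: measurable_eball.
  rewrite (variance_linear_stat pos_finite neg_finite PC (@boxed_eball R n r)).
  have V0 : 0 < r ^+ n * @ball_volume R n.
    by rewrite mulr_gt0 ?exprn_gt0 ?ball_volume_gt0.
  rewrite leb_eball// inver gt_eqF// -EFinM /signed_integral mulrBl.
  have [_ ip _] := fubini_autocorr pos_finite (@boxed_eball R n r).
  have [_ ig _] := fubini_autocorr neg_finite (@boxed_eball R n r).
  by rewrite -!RintegralZr.
have c1 : ('V_Pr[npoints P (eball k.+1%:R)] / leb n (eball k.+1%:R))%E
    @[k --> \oo] --> 0%E.
  apply: (@cvg_comp _ _ _ (fun k => k.+1%:R : R) (fun r : R =>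
    ('V_Pr[npoints P (eball r)] / leb n (eball r))%E) _ (pinfty_nbhs R)) => //.
  by rewrite (cvg_shiftS (fun k => k%:R : R)); exact: cvgr_idn.
have c2 : (\int[spos C]_x overlap k.+1%:R x - \int[sneg C]_x overlap k.+1%:R x)
    @[k --> \oo] --> (0 : R).
  have c1' : (\int[spos C]_x overlap k.+1%:R x -
      \int[sneg C]_x overlap k.+1%:R x)%:E @[k --> \oo] --> (0 : R)%:E.
    by apply: cvg_trans c1; apply: near_eq_cvg; near=> k; rewrite /= e.
  exact: (fine_cvg c1').
have c3 : (\int[spos C]_x overlap k.+1%:R x - \int[sneg C]_x overlap k.+1%:R x)
    @[k --> \oo] --> fine (spos C setT) - fine (sneg C setT).
  by apply: cvgB; exact: overlap_integral_cvg.
have E0 : fine (spos C setT) - fine (sneg C setT) = 0 :=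
  @cvg_unique _ (@Rhausdorff R) _ _ _ _ c3 c2.
have {}E0 := subr0_eq (E0 _).
have fp := lty_fin_num_fun pos_finite measurableT.
have fn := lty_fin_num_fun neg_finite measurableT.
by rewrite -(fineK fp) -(fineK fn) E0.
Unshelve. all: by end_near. Qed.
End hyperuniformity.

(** * Energy of tents *)

Section tents.
Context {R : realType} {n : nat}.
Implicit Types (f g : 'rV[R]_n -> R) (x y : 'rV[R]_n) (L r rho : R).

Lemma bounded_support_increment x f : bounded_support f ->
  bounded_support (increment x f).
Proof.
move=> bf; apply: bounded_supportD; first exact: bounded_support_shift.
have := bounded_supportZ (-1) bf.
by congr bounded_support; apply/funext => y; rewrite mulN1r.
Qed.

Definition tent L y : R := Num.max 0 (Num.min 1 (2 - `|y| / L)).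

Lemma boxed_tent L : 0 < L -> boxed 1 (2 * L) (tent L).
Proof.
move=> L0; split.
- apply: measurable_maxr => //; apply: measurable_minr => //.
  apply: measurable_funB => //; apply: measurable_funM => //.
  exact: measurable_rV_norm.
- by move=> y; rewrite /tent ger0_norm ?le_max ?lexx// ge_max ler01 ge_min lexx.
- move=> y; rewrite -ler_pdivlMr// => h; rewrite /tent; apply/max_idPl.
  by rewrite ge_min subr_le0 h orbT.
Qed.

Lemma tent_eq1 L y : 0 < L -> `|y| <= L -> tent L y = 1.
Proof.
move=> L0; rewrite -[leRHS]mul1r -ler_pdivrMr// => h; rewrite /tent.
rewrite (_ : Num.min _ _ = 1); first exact/max_idPr.
apply/min_idPl; lra.
Qed.

Lemma tent_increment_le1 L x y : `|increment x (tent L) y| <= 1.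
Proof.
have t01 z : 0 <= tent L z <= 1.
  by rewrite /tent le_max lexx/= ge_max ler01 ge_min lexx.
have /andP[a0 a1] := t01 (x + y); have /andP[b0 b1] := t01 y.
rewrite /increment ler_norml; apply/andP; split; lra.
Qed.

Lemma tent_increment_lip L x y : 0 < L -> `|increment x (tent L) y| <= `|x| / L.
Proof.
move=> L0.
have h : `| `|x + y| / L - `|y| / L| <= `|x| / L.
  rewrite -mulrBl normrM (gtr0_norm (_ : 0 < L^-1)) ?invr_gt0//.
  rewrite ler_wpM2r ?invr_ge0 ?(ltW L0)//.
  by have := ler_dist_dist (x + y) y; rewrite addrK.
move: h; rewrite /increment /tent.
move: (`|x + y| / L) (`|y| / L) (`|x| / L) => u v w.
rewrite !ler_norml => /andP[h1 h2].
case: (leP 1 (2 - u)) => a; case: (leP 1 (2 - v)) => b;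
  rewrite ?(max_r ler01); try case: (leP 0 (2 - u)) => c;
  try case: (leP 0 (2 - v)) => d; apply/andP; split; lra.
Qed.

(** The increment of a tent by [x] is supported where this weight is at least
    1, and the integral of the weight does not depend on [x].  It replaces the
    indicator of the union of two cubes. *)
Definition increment_weight L x y : R :=
  \1_(@cube R n (2 * L)) y + \1_(@cube R n (2 * L)) (x + y).

Lemma bounded_support_cube r : bounded_support (\1_(@cube R n r)).
Proof. by exists 1, r; apply: boxed_indic => //; exact: measurable_cube. Qed.

Lemma bounded_support_weight L x : bounded_support (increment_weight L x).
Proof.
apply: bounded_supportD; first exact: bounded_support_cube.
by apply: bounded_support_shift; exact: bounded_support_cube.
Qed.

Lemma integral_increment_weight L x : 0 < L ->
  \int[leb n]_y increment_weight L x y = 2 * (4 * L) ^+ n.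
Proof.
move=> L0; have mc := @measurable_cube R n (2 * L).
have bc := bounded_support_cube (2 * L).
have mi : measurable_fun setT (fun y => (\1_(@cube R n (2 * L)) y : R)%:E).
  by apply: measurableT_comp => //; exact: measurable_indic.
rewrite /increment_weight RintegralD//; last 2 first.
- exact: bounded_support_integrable.
- by apply: bounded_support_integrable; exact: bounded_support_shift.
have E : (\int[leb n]_y (\1_(@cube R n (2 * L)) y)%:E)%E = ((4 * L) ^+ n)%:E.
  by rewrite integral_indic// setIT leb_cube ?mulr_gt0// mulrA -natrM.
rewrite /Rintegral (ge0_integral_translation x mi)// E/=; ring.
Qed.

Lemma tent_increment_weight L x y (b : R) : 0 < L ->
  `|increment x (tent L) y| <= b ->
  `|increment x (tent L) y| <= b * increment_weight L x y.
Proof.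
move=> L0 ub; have b0 : 0 <= b by exact: le_trans ub.
have [_ _ t0] := boxed_tent L0.
rewrite /increment_weight !indicE.
case: (ltP `|y| (2 * L)) => hy.
  rewrite (mem_set (hy : cube (2 * L) y)) -[leLHS]addr0 mulrDr mulr1 lerD// mulr_ge0//.
rewrite memNset ?add0r; last by rewrite /cube/=; apply/negP; rewrite -leNgt.
case: (ltP `|x + y| (2 * L)) => hxy; first by
  rewrite (mem_set (hxy : cube (2 * L) (x + y))) mulr1.
rewrite memNset; last by rewrite /cube/=; apply/negP; rewrite -leNgt.
by rewrite mulr0 /increment t0// t0// subr0 normr0.
Qed.

Lemma tent_increment_sqr_weight L x y (b : R) : 0 < L ->
  `|increment x (tent L) y| <= b ->
  increment x (tent L) y ^+ 2 <= b ^+ 2 * increment_weight L x y.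
Proof.
move=> L0 ub; have b0 : 0 <= b by exact: le_trans ub.
rewrite -real_normK ?num_real// !expr2 -mulrA ler_pM//.
exact: tent_increment_weight.
Qed.

Lemma bounded_support_tent L : 0 < L -> bounded_support (tent L).
Proof. by move=> L0; exists 1, (2 * L); exact: boxed_tent. Qed.

Lemma energy_tent L x (b : R) : 0 < L ->
  (forall y, `|increment x (tent L) y| <= b) ->
  energy (tent L) x <= b ^+ 2 * (2 * (4 * L) ^+ n).
Proof.
move=> L0 ub; have bt := bounded_support_increment x (bounded_support_tent L0).
have bw := bounded_support_weight L x.
rewrite -(integral_increment_weight x L0) -RintegralZl//; last first.
  exact: bounded_support_integrable.
apply: le_Rintegral => //.
- by apply: bounded_support_integrable; exact: (bounded_supportM bt bt).
- by apply: bounded_support_integrable; exact: bounded_supportZ.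
- by move=> y _; exact: tent_increment_sqr_weight.
Qed.

Lemma increment_L1_tent L x : 0 < L ->
  \int[leb n]_y `|increment x (tent L) y| <= `|x| / L * (2 * (4 * L) ^+ n).
Proof.
move=> L0; have bt := bounded_support_increment x (bounded_support_tent L0).
have bw := bounded_support_weight L x.
rewrite -(integral_increment_weight x L0) -RintegralZl//; last first.
  exact: bounded_support_integrable.
apply: le_Rintegral => //.
- by apply: bounded_support_integrable; exact: bounded_support_norm.
- by apply: bounded_support_integrable; exact: bounded_supportZ.
- by move=> y _; apply: tent_increment_weight => //; exact: tent_increment_lip.
Qed.

(** Tents at dyadic scales.  At scale [L] the increment by [x] is at most
    [`|x| / L], on a region of area of order [L ^+ 2]; hence increments at
    distinct scales [L < L'] have an inner product at most of order
    [`|x| ^+ 2 * L / L'], which is summable over the smaller scales. *)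
Definition tent_sum rho N y : R := \sum_(k < N) tent (rho * 2 ^+ k) y.

Lemma increment_tent_sumS rho N x y :
  increment x (tent_sum rho N.+1) y =
  increment x (tent_sum rho N) y + increment x (tent (rho * 2 ^+ N)) y.
Proof. by rewrite /increment /tent_sum !big_ord_recr/=; ring. Qed.

Lemma bounded_support_tent_sum rho N :
  0 < rho -> bounded_support (tent_sum rho N).
Proof.
move=> rho0; elim: N => [|N IH].
  rewrite (_ : tent_sum rho 0 = fun=> 0).
    exists 0, 0; split; first exact: measurable_cst.
      by move=> x; rewrite normr0.
    by [].
  by apply/funext => y; rewrite /tent_sum big_ord0.
rewrite (_ : tent_sum rho N.+1 =
    fun y => tent_sum rho N y + tent (rho * 2 ^+ N) y).
  apply: bounded_supportD => //; apply: bounded_support_tent.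
  by rewrite mulr_gt0 ?exprn_gt0.
by apply/funext => y; rewrite /tent_sum big_ord_recr.
Qed.

(** The new tent contributes at most [32 * `|x|] times its scale, and the
    scales double, so the bound by the next scale reproduces itself. *)
Lemma increment_L1_tent_sum rho N x : n = 2%N -> 0 < rho ->
  \int[leb n]_y `|increment x (tent_sum rho N) y| <= 32 * `|x| * (rho * 2 ^+ N).
Proof.
move=> n2 rho0; elim: N => [|N IH].
  rewrite (_ : (fun y => _) = fun=> 0).
    by rewrite Rintegral_cst// mul0r !mulr_ge0// ltW.
  by apply/funext => y; rewrite /increment /tent_sum !big_ord0 subr0 normr0.
have L0 : 0 < rho * 2 ^+ N by rewrite mulr_gt0 ?exprn_gt0.
have bG := bounded_support_increment x (bounded_support_tent_sum N rho0).
have bT := bounded_support_increment x (bounded_support_tent L0).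
have bG' := bounded_support_increment x (bounded_support_tent_sum N.+1 rho0).
apply: (@le_trans _ _ (\int[leb n]_y (`|increment x (tent_sum rho N) y| +
    `|increment x (tent (rho * 2 ^+ N)) y|))).
  apply: le_Rintegral => //.
  - by apply: bounded_support_integrable; exact: bounded_support_norm.
  - by apply: bounded_support_integrable; apply: bounded_supportD;
      exact: bounded_support_norm.
  - by move=> y _; rewrite increment_tent_sumS ler_normD.
rewrite RintegralD//; last 2 first.
- by apply: bounded_support_integrable; exact: bounded_support_norm.
- by apply: bounded_support_integrable; exact: bounded_support_norm.
have := increment_L1_tent x L0.
have -> : (4 * (rho * 2 ^+ N)) ^+ n = (4 * (rho * 2 ^+ N)) ^+ 2 by rewrite n2.
rewrite (_ : `|x| / (rho * 2 ^+ N) * _ = 32 * `|x| * (rho * 2 ^+ N)); last first.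
  by field; rewrite gt_eqF//= gt_eqF// exprn_gt0.
move=> h; rewrite exprS; lra.
Qed.

(** Adding the tent of scale [L] changes the energy by its own energy, at most
    [32 * `|x| ^+ 2], and by twice an inner product, at most [2 * `|x| / L]
    times the previous [L1] norm, that is [64 * `|x| ^+ 2].  The growth is thus
    linear in [N], while the squares of the values on the cube grow like
    [N ^+ 2]. *)
Lemma energy_tent_sum rho N x : n = 2%N -> 0 < rho ->
  energy (tent_sum rho N) x <= 96 * N%:R * `|x| ^+ 2.
Proof.
move=> n2 rho0; elim: N => [|N IH].
  rewrite /energy (_ : (fun y => _) = fun=> 0).
    by rewrite Rintegral_cst// mul0r mulr0 mul0r.
  by apply/funext => y; rewrite /increment /tent_sum !big_ord0 subr0 expr0n.
set L := rho * 2 ^+ N.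
have L0 : 0 < L by rewrite mulr_gt0 ?exprn_gt0.
pose b := `|x| / L.
have bG := bounded_support_increment x (bounded_support_tent_sum N rho0).
have bG' := bounded_support_increment x (bounded_support_tent_sum N.+1 rho0).
have bw := bounded_support_weight L x.
have b1 := bounded_support_sqr bG.
have b2 := bounded_supportZ (2 * b) (bounded_support_norm bG).
have b3 := bounded_supportZ (b ^+ 2) bw.
apply: (@le_trans _ _ (\int[leb n]_y (increment x (tent_sum rho N) y ^+ 2 +
    (2 * b * `|increment x (tent_sum rho N) y| +
     b ^+ 2 * increment_weight L x y)))).
  apply: le_Rintegral => //.
  - by apply: bounded_support_integrable; exact: bounded_support_sqr.
  - by apply: bounded_support_integrable; do 2 apply: bounded_supportD => //.
  - move=> y _; rewrite increment_tent_sumS -/L.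
    have h1 := tent_increment_lip x y L0.
    have h2 := tent_increment_sqr_weight L0 h1.
    rewrite -/b in h1 h2.
    set u := increment x (tent_sum rho N) y.
    set v := increment x (tent L) y in h1 h2 *.
    have h3 : u * v <= b * `|u|.
      by apply: le_trans (ler_norm _) _; rewrite normrM mulrC ler_wpM2r.
    rewrite sqrrD; lra.
rewrite RintegralD//; last 2 first.
- exact: bounded_support_integrable.
- by apply: bounded_support_integrable; exact: bounded_supportD.
rewrite RintegralD//;
  [|exact: bounded_support_integrable|exact: bounded_support_integrable].
rewrite RintegralZl//; last first.
  by apply: bounded_support_integrable; exact: bounded_support_norm.
rewrite RintegralZl//; last exact: bounded_support_integrable.
rewrite integral_increment_weight//.
have -> : (4 * L) ^+ n = (4 * L) ^+ 2 by rewrite n2.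
have h1 : 2 * b * \int[leb n]_y `|increment x (tent_sum rho N) y| <=
    64 * `|x| ^+ 2.
  rewrite (_ : 64 * _ = 2 * b * (32 * `|x| * L)); last first.
    by rewrite /b; field; rewrite gt_eqF.
  apply: ler_wpM2l; first by rewrite mulr_ge0// divr_ge0// ltW.
  exact: increment_L1_tent_sum.
have h2 : b ^+ 2 * (2 * (4 * L) ^+ 2) = 32 * `|x| ^+ 2.
  by rewrite /b; field; rewrite gt_eqF.
rewrite h2 -natr1; rewrite /energy in IH; lra.
Qed.

End tents.

(** * Functions with vanishing energy *)

Section vanishing_energy.
Context {R : realType} {n : nat}.
Implicit Types (f g : 'rV[R]_n -> R) (x y : 'rV[R]_n) (L r rho : R).

Lemma energyZ (c : R) f x : bounded_support f ->
  energy (fun y => c * f y) x = c ^+ 2 * energy f x.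
Proof.
move=> bf; rewrite /energy -RintegralZl//; last first.
  apply: bounded_support_integrable; apply: bounded_support_sqr.
  exact: bounded_support_increment.
by apply: eq_Rintegral => y _; rewrite /increment; ring.
Qed.

(** [g] is a measurable majorant of the energies to which dominated
    convergence applies; 96 is the larger of the constants obtained on the
    line and in the plane. *)
Definition vanishing_energy rho (f g : nat -> 'rV[R]_n -> R) :=
  [/\ forall k, bounded_support (f k) /\ (forall x, `|x| <= rho -> f k x = 1),
      forall k x, energy (f k) x <= g k x,
      forall k, measurable_fun setT (g k),
      forall k x, 0 <= g k x <= 96 * `|x| ^+ n &
      forall x, g k x @[k --> \oo] --> (0 : R)].

(** The increment of a tent of width [L] is bounded by 1 and by [`|x| / L], and
    the energy is of order [L] times the square of the smaller one.  The product
    of the two bounds keeps it below a multiple of [`|x|]; the square of the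
    second makes it tend to 0 as [L] grows. *)
Lemma vanishing_energy_dim1 rho : n = 1%N -> 0 < rho ->
  exists f g : nat -> 'rV[R]_n -> R, vanishing_energy rho f g.
Proof.
move=> n1 rho0; pose L k : R := rho * k.+1%:R.
have L0 k : 0 < L k by rewrite mulr_gt0.
pose b k x := Num.min 1 (`|x| / L k).
have b0 k x : 0 <= b k x by rewrite le_min ler01 divr_ge0// ltW.
exists (fun k => tent (L k)), (fun k x => 8 * L k * b k x ^+ 2); split.
- move=> k; split; first exact: bounded_support_tent.
  move=> x xr; apply: tent_eq1 => //; apply: le_trans xr _.
  by rewrite /L ler_peMr ?(ltW rho0)// ler1n.
- move=> k x.
  have -> : 8 * L k * b k x ^+ 2 = b k x ^+ 2 * (2 * (4 * L k) ^+ n).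
    have -> : (4 * L k) ^+ n = 4 * L k by rewrite n1 expr1.
    by ring.
  apply: energy_tent => // y.
  by rewrite le_min tent_increment_le1 tent_increment_lip.
- move=> k; apply: measurable_funM => //; apply: measurable_funX.
  apply: measurable_minr => //; apply: measurable_funM => //.
  exact: measurable_rV_norm.
- move=> k x; rewrite !mulr_ge0 ?sqr_ge0 ?(ltW rho0)//=.
  have -> : `|x| ^+ n = `|x| by rewrite -[RHS]expr1; congr (_ ^+ _).
  apply: (@le_trans _ _ (8 * L k * (`|x| / L k))).
    apply: ler_wpM2l; first by rewrite mulr_ge0// ltW.
    rewrite expr2 -[leRHS]mul1r ler_pM//; first by rewrite ge_min lexx.
    by rewrite ge_min lexx orbT.
  rewrite (_ : 8 * L k * (`|x| / L k) = 8 * `|x|); last by field; rewrite gt_eqF.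
  by rewrite ler_wpM2r// ler_nat.
- move=> x.
  have c0 : 8 * `|x| ^+ 2 / rho * harmonic k @[k --> \oo] --> (0 : R).
    rewrite -[X in _ --> X](mulr0 (8 * `|x| ^+ 2 / rho)).
    by apply: cvgMr; exact: cvg_harmonic.
  apply: (squeeze_cvgr _ (cvg_cst (0 : R)) c0); near=> k.
  rewrite !mulr_ge0 ?sqr_ge0 ?(ltW rho0)//=.
  rewrite (_ : 8 * _ / _ * _ = 8 * L k * (`|x| / L k) ^+ 2); last first.
    rewrite /L /harmonic/=; field.
    by rewrite -[1]/(1%:R) -natrD pnatr_eq0/= gt_eqF.
  rewrite ler_wpM2l ?mulr_ge0 ?(ltW rho0)//.
  by rewrite !expr2 ler_pM// ge_min lexx orbT.
Unshelve. all: by end_near. Qed.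

(** Averaging [k.+1] dyadic tents divides an energy linear in [k.+1] by
    [k.+1 ^+ 2]. *)
Lemma vanishing_energy_dim2 rho : n = 2%N -> 0 < rho ->
  exists f g : nat -> 'rV[R]_n -> R, vanishing_energy rho f g.
Proof.
move=> n2 rho0.
exists (fun k y => k.+1%:R^-1 * tent_sum rho k.+1 y),
  (fun k x => 96 * `|x| ^+ 2 * harmonic k); split.
- move=> k; split.
    by apply: bounded_supportZ; exact: bounded_support_tent_sum.
  move=> x xr; rewrite /tent_sum (eq_bigr (fun=> 1)) => [|i _]; last first.
    apply: tent_eq1; first by rewrite mulr_gt0 ?exprn_gt0.
    by apply: le_trans xr _; rewrite ler_peMr ?(ltW rho0)// exprn_ege1// ler1n.
  by rewrite sumr_const card_ord mulVf ?pnatr_eq0.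
- move=> k x; rewrite energyZ; last exact: bounded_support_tent_sum.
  rewrite (_ : 96 * `|x| ^+ 2 * harmonic k =
      k.+1%:R^-1 ^+ 2 * (96 * k.+1%:R * `|x| ^+ 2)).
    by rewrite ler_wpM2l ?sqr_ge0//; exact: energy_tent_sum.
  by rewrite /harmonic/=; field; rewrite -[1]/(1%:R) -natrD pnatr_eq0.
- move=> k; apply: measurable_funM => //; apply: measurable_funM => //.
  by apply: measurable_funX; exact: measurable_rV_norm.
- move=> k x; have -> : `|x| ^+ n = `|x| ^+ 2 by congr (_ ^+ _).
  rewrite !mulr_ge0 ?sqr_ge0 ?harmonic_ge0//=.
  by rewrite ler_piMr ?mulr_ge0 ?sqr_ge0// /harmonic/= invf_le1// ler1n.
- move=> x; rewrite -[X in _ --> X](mulr0 (96 * `|x| ^+ 2)).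
  by apply: cvgMr; exact: cvg_harmonic.
Qed.

(** The moment controls the mass outside the unit cube, local finiteness the
    mass inside. *)
Lemma finite_of_finite_moment (mu : {measure set 'rV[R]_n -> \bar R}) :
  locally_finite mu -> (\int[mu]_t (enorm t ^+ n)%:E < +oo)%E ->
  (mu setT < +oo)%E.
Proof.
move=> lf moo.
have me := @measurable_enormX R n n.
have mc := @measurable_cube R n 1.
have mi : measurable_fun setT (fun t => (\1_(@cube R n 1) t : R)%:E).
  by apply: measurableT_comp => //; exact: measurable_indic.
apply: (@le_lt_trans _ _
    (\int[mu]_t ((\1_(@cube R n 1) t : R)%:E + (enorm t ^+ n)%:E))%E).
  rewrite -[leLHS]mul1e -integral_cst//; apply: ge0_le_integral => //.
  - exact: emeasurable_funD.
  - move=> t _; rewrite -EFinD lee_fin indicE.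
    case: (ltP `|t| 1) => t1.
      by rewrite (mem_set (t1 : cube 1 t)) lerDl exprn_ge0// enorm_ge0.
    rewrite memNset; last by rewrite /cube/=; apply/negP; rewrite -leNgt.
    by rewrite add0r exprn_ege1// (le_trans t1)// norm_le_enorm.
rewrite ge0_integralD//.
  by rewrite integral_indic// setIT lte_add_pinfty//; exact: locally_finite_cube.
by move=> t _; rewrite lee_fin exprn_ge0// enorm_ge0.
Qed.

End vanishing_energy.

(** * Rigidity *)

Section rigidity.
Context {R : realType} {n : nat}.
Context (C : signed_radon R n).
Context {d' : measure_display} {Omega : measurableType d'}.
Context (Pr : probability Omega R) (P : R.-ker Omega ~> 'rV[R]_n).

(** Dominated convergence against the negative part of [C].  The conclusion is
    about an arbitrary lower bound [v] of the variances because it is applied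
    to the infimum that defines rigidity. *)
Lemma variance_lower_bound_le0 (rho : R) (f g : nat -> 'rV[R]_n -> R) :
  correlation_measure Pr P C -> hyperuniform Pr P ->
  (\int[total_variation_measure C]_t (enorm t ^+ n)%:E < +oo)%E ->
  vanishing_energy rho f g ->
  forall v, (forall k, v <= 'V_Pr[linear_stat P (f k)])%E -> (v <= 0)%E.
Proof.
move=> PC hP moo [bf fg mg g0 gc] v vV.
have me := @measurable_enormX R n n.
have e0 (t : 'rV[R]_n) : (0 <= (enorm t ^+ n)%:E)%E.
  by rewrite lee_fin exprn_ge0// enorm_ge0.
move: moo; rewrite ge0_integral_measure_add// => moo.
have p0 : (0 <= \int[spos C]_t (enorm t ^+ n)%:E)%E by exact: integral_ge0.
have q0 : (0 <= \int[sneg C]_t (enorm t ^+ n)%:E)%E by exact: integral_ge0.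
have pm : (\int[spos C]_t (enorm t ^+ n)%:E < +oo)%E.
  by apply: le_lt_trans moo; rewrite leeDl.
have nm : (\int[sneg C]_t (enorm t ^+ n)%:E < +oo)%E.
  by apply: le_lt_trans moo; rewrite leeDr.
have poo := finite_of_finite_moment (@spos_locally_finite _ _ C) pm.
have noo := finite_of_finite_moment (@sneg_locally_finite _ _ C) nm.
have C0 := hyperuniform_total_mass poo noo PC hP.
pose G (t : 'rV[R]_n) : R := 96 * enorm t ^+ n.
have iG : (sneg C).-integrable setT (EFin \o G).
  apply: (@integrableZl _ _ _ (sneg C) _ measurableT 96
    (fun t => (enorm t ^+ n)%:E)).
  apply/integrableP; split => //.
  by under eq_integral do rewrite gee0_abs//.
have gG k t : `|g k t| <= G t.
  have /andP[gk0 gk1] := g0 k t; rewrite ger0_norm//; apply: le_trans gk1 _.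
  by rewrite ler_wpM2l// lerXn2r ?nnegrE ?enorm_ge0// norm_le_enorm.
have mgk k : measurable_fun setT (EFin \o g k) by exact/measurable_EFinP.
have ig k : (sneg C).-integrable setT (EFin \o g k).
  apply: (le_integrable measurableT (mgk k) _ iG) => x _ /=.
  by rewrite lee_fin (le_trans (gG k x))// ler_norm.
have [|||_ _ H] := @dominated_convergence _ _ _ (sneg C) _ measurableT
  (fun k => EFin \o g k) (EFin \o cst (0 : R)) (EFin \o G)
  mgk _ _ iG.
- exact/measurable_EFinP.
- by apply: aeW => x _ /=; apply: cvg_EFin; [exact: nearW | exact: gc].
- by apply: aeW => x k _ /=; rewrite lee_fin gG.
have {}H : (\int[sneg C]_x (g k x)%:E)%E @[k --> \oo] --> 0%E.
  by move: H; rewrite [X in _ --> X]integral0_eq.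
apply: (cvge_ge _ H); apply: nearW => k; apply: le_trans (vV k) _.
have [[M [r bfk]] _] := bf k.
exact: (variance_le_energy poo noo PC C0 bfk (ig k) (fg k)).
Qed.

Lemma rigid_of_vanishing_energy (rho : R) (f g : nat -> 'rV[R]_n -> R)
    (A : set 'rV[R]_n) :
  point_process P ->
  correlation_measure Pr P C -> hyperuniform Pr P ->
  (\int[total_variation_measure C]_t (enorm t ^+ n)%:E < +oo)%E ->
  vanishing_energy rho f g ->
  measurable A -> (forall x, A x -> `|x| <= rho) ->
  linearly_number_rigid Pr P A.
Proof.
move=> pP PC hP moo vfg mA Arho.
apply/eqP; rewrite eq_le; apply/andP; split; last first.
  by apply: le_ereal_inf_tmp => _ [h _ <-]; exact: variance_ge0.
apply: (variance_lower_bound_le0 PC hP moo vfg) => k.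
have [/(_ k)[[M [r bf]] f1] _ _ _ _] := vfg.
have lfP w : locally_finite (P w).
  by move=> B mB bB; have [m ->] := pP w B mB bB; exact: ltry.
have bA : boxed 1 (rho + 1) (\1_A).
  apply: boxed_indic => // x /Arho xr; rewrite /cube/=.
  by apply: le_lt_trans xr _; rewrite ltrDl.
(* Removing from [f k] its part on A, where it equals 1, leaves a competitor in
   the infimum. *)
pose h x := \1_A x - f k x.
have -> : linear_stat P (f k) = (fun w => npoints P A w - linear_stat P h w).
  apply/funext => w; rewrite (npoints_linear_stat P w mA) /linear_stat.
  rewrite /h RintegralB//;
    [|exact: boxed_integrable (lfP w) bA|exact: boxed_integrable (lfP w) bf].
  by rewrite subKr.
apply: ereal_inf_lbound; exists h => //; split.
  have [||M' [r' bh]] := @bounded_supportD R n (\1_A) (fun x => -1 * f k x).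
  - by exists 1, (rho + 1).
  - by apply: bounded_supportZ; exists M, r.
  apply: (@boxed_test _ _ M' r'); move: bh.
  by congr boxed; apply/funext => x; rewrite mulN1r.
by move=> x Ax; rewrite /h indicE mem_set// f1 ?subrr//; exact: Arho.
Qed.

End rigidity.

Theorem corollary4 (R : realType) (d : nat) (d' : measure_display)
    (Omega : measurableType d') (Pr : probability Omega R)
    (P : R.-ker Omega ~> 'rV[R]_d) (C : signed_radon R d) (A : set 'rV[R]_d) :
  d = 1%N \/ d = 2%N ->
  point_process P ->
  stationary Pr P ->
  isotropic Pr P ->
  locally_square_integrable Pr P ->
  hyperuniform Pr P ->
  correlation_measure Pr P C ->
  measurable A -> bounded_set A ->
  ~ linearly_number_rigid Pr P A ->
  (\int[total_variation_measure C]_t (enorm t ^+ d)%:E = +oo)%E.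
Proof.
move=> d12 pP _ _ _ hP PC mA [M [_ AM]] nrigid.
apply/eqP; apply: contra_notT nrigid; rewrite -ltey => moo.
pose rho := Num.max (M + 1) 1.
have rho0 : 0 < rho by rewrite lt_max ltr01 orbT.
have Arho x : A x -> `|x| <= rho.
  by move=> Ax; rewrite le_max (AM (M + 1))// ltrDl.
have [f [g vfg]] : exists f g : nat -> 'rV[R]_d -> R, vanishing_energy rho f g.
  by case: d12 => d12; [exact: vanishing_energy_dim1|exact: vanishing_energy_dim2].
exact: (rigid_of_vanishing_energy pP PC hP moo vfg mA Arho).
Qed.
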